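(* Let $\Omega\subset\mathbb{R}^2$ be bounded and let $\{P^i\}_{i=1}^d$ be a polyhedral partition of $\Omega$, i.e. the $P^i$ are (bounded, nonempty) polyhedra with $\bigcup_{i=1}^d P^i=\Omega$ and $\operatorname{relint}(P^i)\cap\operatorname{relint}(P^j)=\emptyset$ for all distinct $i,j$. Let $J=\bigcup_{i=1}^d\operatorname{ext}(P^i)$ and suppose the internal vertex condition holds: $$v\in P^i\iff v\in\operatorname{ext}(P^i)\qquad\forall i\in\{1,\ldots,d\},\ v\in J.$$ If $\mathscr{S}=\{\operatorname{ext}(P^i)\}_{i=1}^d$, then $r(H^c_{\mathscr{S}})\le 3$, i.e. every minimal infeasible subset of $J$ has at most $3$ elements.
   Context: $\operatorname{ext}(P)$ is the set of extreme points and $\operatorname{relint}(P)$ the relative interior of $P$. For a family $\mathscr{S}$ of subsets of $J$, a set $T\subseteq J$ is feasible if $T\subseteq S$ for some $S\in\mathscr{S}$, and infeasible otherwise. The conflict hypergraph $H^c_{\mathscr{S}}$ has vertex set $J$ and hyperedges all (inclusionwise) minimal infeasible subsets of $J$; $r(H^c_{\mathscr{S}})$ is the maximum cardinality of a hyperedge ($0$ if there is none). Standing assumption: $\mathscr{S}$ is irredundant (there are no distinct $S,T\in\mathscr{S}$ with $S\subseteq T$); that $\mathscr{S}$ covers $J$ is automatic here. *)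

(* Defs.v *)
From HB Require Import structures.
From mathcomp Require Import all_boot all_order all_algebra.
From mathcomp Require Import all_classical all_reals all_analysis.

Set Implicit Arguments.
Unset Strict Implicit.
Unset Printing Implicit Defensive.

Import Order.TTheory GRing.Theory Num.Theory.
Import numFieldNormedType.Exports.

Local Open Scope classical_set_scope.
Local Open Scope ring_scope.

Definition affine_hull (R : realType) (E : lmodType R) (A : set E) : set E :=
  [set x | exists m (c : 'I_m -> R) (a : 'I_m -> E),
    [/\ forall k, A (a k), \sum_k c k = 1 & x = \sum_k c k *: a k]].

(* The interior of A relative to its affine hull. *)
Definition relint (R : realType) (E : normedModType R) (A : set E) : set E :=
  [set x | A x /\ \forall y \near x, affine_hull A y -> A y].

Definition ext (R : realType) (E : lmodType R) (A : set E) : set E :=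
  [set x | A x /\ forall y z t, A y -> A z -> 0 < t < 1 ->
     x = t *: y + (1 - t) *: z -> y = z].

(* A finite intersection of closed half-spaces; m = 0 gives the whole space.
   Boundedness is not part of the definition. *)
Definition polyhedron (R : realType) n (A : set 'cV[R]_n) : Prop :=
  exists m (M : 'M[R]_(m, n)) (b : 'cV[R]_m),
    A = [set x | forall k, (M *m x) k ord0 <= b k ord0].

(* The dimension is n.+1 because matrices carry a normed module structure only
   when both sizes are syntactically successors. *)
Definition polyhedral_partition (R : realType) n (Omega : set 'cV[R]_n.+1)
    d (P : 'I_d -> set 'cV[R]_n.+1) : Prop :=
  [/\ forall i, [/\ polyhedron (P i), bounded_set (P i) & P i !=set0],
      \bigcup_i P i = Omega
    & forall i j, i != j -> relint (P i) `&` relint (P j) = set0].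

Definition feasible V (F : set (set V)) (T : set V) : Prop :=
  exists2 S, F S & T `<=` S.

Definition irredundant V (F : set (set V)) : Prop :=
  forall S T, F S -> F T -> S `<=` T -> S = T.

Definition minimal_infeasible V (J : set V) (F : set (set V)) (T : set V) :=
  [/\ T `<=` J, ~ feasible F T
    & forall T', T' `<=` T -> ~ feasible F T' -> T' = T].

Record hypergraph (V : Type) := Hypergraph {
  hverts : set V;
  hedges : set (set V);
  hedges_sub : forall e, hedges e -> e `<=` hverts }.

Lemma minimal_infeasible_sub V (J : set V) (F : set (set V)) (T : set V) :
  minimal_infeasible J F T -> T `<=` J.
Proof. by case. Qed.

Definition conflict_hypergraph V (J : set V) (F : set (set V)) : hypergraph V :=
  Hypergraph (@minimal_infeasible_sub V J F).

(* The maximum cardinality of a hyperedge. It is extended-real valued, so that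
   an infinite hyperedge, or hyperedges of unbounded size, give +oo rather than
   a junk value; the outer maximum gives 0 when there is no hyperedge. *)
Definition hrank (R : realType) (V : choiceType) (H : hypergraph V) : \bar R :=
  Order.max 0%E (ereal_sup [set counting e | e in hedges H]).

(* Main.v *)
Require Import Defs.
From HB Require Import structures.
From mathcomp Require Import all_boot all_order all_algebra.
From mathcomp Require Import all_classical all_reals all_analysis.
From mathcomp Require Import finmap ring lra.
Import Order.TTheory GRing.Theory Num.Theory.
Import numFieldNormedType.Exports.
Local Open Scope classical_set_scope.
Local Open Scope ring_scope.

(** Four points of a minimal infeasible set [T] already give a contradiction.
    For [v] in [T], some cell [Q v] has all points of [T] other than [v] as
    extreme points; by the internal vertex condition it does not contain [v].
    Hence the cells [Q v] are pairwise distinct and no three of the four points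
    are collinear.  If a point [v] lies in the triangle of the other three,
    then [Q v] contains [v]; otherwise the points are
    in convex position, with the segments [ab] and [cd] crossing, and the cells
    [Q a] (containing the triangle [bcd]) and [Q c] (containing [abd]) have
    overlapping interiors. *)

Section Plane.
Set Implicit Arguments.
Unset Strict Implicit.
Context {R : realType}.
Implicit Types (a b c d x y : 'cV[R]_2) (A : set 'cV[R]_2).

(** * Convexity, signed areas and extreme points in the plane *)

(** Convexity in three-point form, so that barycentric coordinates in a triangle apply directly. *)
Definition tri_closed A := forall b c d (p q r : R), A b -> A c -> A d ->
  0 <= p -> 0 <= q -> 0 <= r -> p + q + r = 1 ->
  A (p *: b + q *: c + r *: d).

Lemma polyhedron_tri_closed A : polyhedron A -> tri_closed A.
Proof.
move=> [m [M [h ->]]] b c d p q r /= Ab Ac Ad p0 q0 r0 pqr k.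
rewrite !mulmxDr -!scalemxAr !mxE.
move: (Ab k) (Ac k) (Ad k); rewrite !mxE => Hb Hc Hd.
rewrite -[leRHS]mul1r -pqr !mulrDl.
by rewrite !lerD// ler_wpM2l.
Qed.

(** Twice the signed area of the triangle [abc]; it vanishes exactly for collinear points. *)
Definition orient a b c : R :=
  (b 0 0 - a 0 0) * (c 1 0 - a 1 0) - (b 1 0 - a 1 0) * (c 0 0 - a 0 0).

Lemma cV2P x y : x 0 0 = y 0 0 -> x 1 0 = y 1 0 -> x = y.
Proof.
move=> h0 h1; apply/colP => -[[|[|//]] hi].
- by rewrite (_ : Ordinal hi = 0) //; exact: val_inj.
- by rewrite (_ : Ordinal hi = 1) //; exact: val_inj.
Qed.

(** Of three distinct collinear points one lies strictly between the other two, so it is not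
    extreme. *)
Lemma ext_orient_neq0 A a b c : ext A a -> ext A b -> ext A c ->
  a <> b -> a <> c -> b <> c -> orient a b c != 0.
Proof.
move=> [Aa ea] [Ab eb] [Ac ec] ab ac bc; apply/eqP => D0.
have [s cE] : exists s, c = (1 - s) *: a + s *: b.
  (* The parameter [s] is read off from a coordinate in which [a] and [b] differ. *)
  have [h0|h0] := eqVneq (b 0 0) (a 0 0); last first.
    have h : b 0 0 - a 0 0 != 0 by rewrite subr_eq0.
    exists ((c 0 0 - a 0 0) / (b 0 0 - a 0 0)).
    apply: cV2P; rewrite !mxE; first by field.
    apply: (mulfI h); apply/eqP; rewrite -subr_eq0 -D0 /orient; apply/eqP.
    by field.
  have [h1|h1] := eqVneq (b 1 0) (a 1 0); first by case: ab; apply: cV2P.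
  have h : b 1 0 - a 1 0 != 0 by rewrite subr_eq0.
  exists ((c 1 0 - a 1 0) / (b 1 0 - a 1 0)).
  apply: cV2P; rewrite !mxE; last by field.
  move: D0; rewrite /orient h0 subrr mul0r sub0r => /eqP.
  by rewrite oppr_eq0 mulf_eq0 (negPf h)/= subr_eq0 => /eqP ->; ring.
(* The middle point is [a] for [s < 0], [c] for [0 < s < 1] and [b] for [s > 1]; the values 0 and 1
   make [c] equal to [a] or [b]. *)
have [s0|s0|s0] := ltgtP s 0.
- have s1 : 1 - s != 0 by rewrite gt_eqF// subr_gt0 (lt_trans s0).
  apply: bc; symmetry; apply: (ea c b ((1 - s)^-1)) => //.
    by clear -s0; rewrite invr_gt0 invf_lt1; lra.
  by rewrite cE; apply: cV2P; rewrite !mxE; field.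
- have [s1|s1|s1] := ltgtP s 1.
  + apply: ab; apply: (ec a b (1 - s)) => //; first by clear -s0 s1; lra.
    by rewrite cE; apply: cV2P; rewrite !mxE; ring.
  + have sn0 : s != 0 by rewrite gt_eqF.
    apply: ac; symmetry; apply: (eb c a s^-1) => //.
      by clear -s0 s1; rewrite invr_gt0 invf_lt1; lra.
    by rewrite cE; apply: cV2P; rewrite !mxE; field.
  + by apply: bc; rewrite cE s1; apply: cV2P; rewrite !mxE; ring.
- by apply: ac; rewrite cE s0; apply: cV2P; rewrite !mxE; ring.
Qed.

(** * Interior points of triangles *)

Lemma orient_continuous b c : continuous (fun y => orient y b c).
Proof.
move=> x; rewrite /orient.
have h i : (fun y => y i 0 : R) @ x --> x i 0 by exact: coord_continuous.
apply: (@cvgB _ _ _ _ (nbhs_filter x)); apply: (@cvgM _ _ _ (nbhs_filter x)).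
all: apply: (@cvgB _ R _ _ (nbhs_filter x)); first [exact: cvg_cst | exact: h].
Qed.

(** Barycentric coordinates are quotients of signed areas, hence continuous. Being positive at the
    given point, they stay positive nearby, so a full planar neighbourhood lies in [A]. *)
Lemma relint_triangle A b c d (p q r : R) : tri_closed A ->
  A b -> A c -> A d -> orient b c d != 0 ->
  0 < p -> 0 < q -> 0 < r -> p + q + r = 1 ->
  relint A (p *: b + q *: c + r *: d).
Proof.
move=> hA Ab Ac Ad D0 p0 q0 r0 pqr.
set x := p *: b + q *: c + r *: d.
split; first by apply: hA => //; exact: ltW.
have rE : r = 1 - p - q by rewrite -pqr; ring.
have pos u v (w : R) : 0 < w -> orient x u v / orient b c d = w ->
    \forall y \near x, 0 < orient y u v / orient b c d.
  move=> w0 wE; apply: (@cvgr_gt _ _ (nbhs x) _ _ w) => //.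
  rewrite -wE; apply: cvgM; last exact: cvg_cst.
  exact: orient_continuous.
(* The point [x] is paired with the edges in the cyclic order [cd], [db], [bc], which keeps the
   signs consistent. *)
have H1 : orient x c d / orient b c d = p.
  apply: (mulIf D0); rewrite divfK// /x rE /orient !mxE; ring.
have H2 : orient x d b / orient b c d = q.
  apply: (mulIf D0); rewrite divfK// /x rE /orient !mxE; ring.
have H3 : orient x b c / orient b c d = r.
  apply: (mulIf D0); rewrite divfK// /x rE /orient !mxE; ring.
near=> y => _.
have -> : y = (orient y c d / orient b c d) *: b
    + (orient y d b / orient b c d) *: c + (orient y b c / orient b c d) *: d.
  by apply: cV2P; rewrite !mxE; move: D0; rewrite /orient => D0; field.
apply: hA => //.
- by apply: ltW; near: y; exact: pos H1.
- by apply: ltW; near: y; exact: pos H2.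
- by apply: ltW; near: y; exact: pos H3.
- by move: D0; rewrite /orient => D0; field.
Unshelve. all: by end_near. Qed.

(** * Affine dependences of four points *)

(** Solving the dependence for [a] makes it a convex combination of [b], [c], [d]. *)
Lemma affine_dep_inside A a b c d (wa wb wc wd : R) : tri_closed A ->
  A b -> A c -> A d -> 0 < wa -> wb < 0 -> wc < 0 -> wd < 0 ->
  wa + wb + wc + wd = 0 ->
  wa *: a + wb *: b + wc *: c + wd *: d = 0 -> A a.
Proof.
move=> hA Ab Ac Ad wa0 wb0 wc0 wd0 ws wv.
have wn : wa != 0 by rewrite gt_eqF.
have wE : wa = - wb - wc - wd by clear -ws; lra.
have -> : a = (- wb / wa) *: b + (- wc / wa) *: c + (- wd / wa) *: d.
  apply: (scalerI wn); rewrite !scalerDr !scalerA ![wa * (_ / wa)]mulrC.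
  rewrite !divfK//; apply/eqP; rewrite -subr_eq0 -wv; apply/eqP.
  by apply: cV2P; rewrite !mxE; ring.
apply: hA => //; try by rewrite divr_ge0 ?oppr_ge0// ltW.
by rewrite -!mulrDl -wE divff.
Qed.

(** Moving the negative terms across and dividing by [wa + wb] gives a common point of the segments
    [ab] and [cd]. Averaged with the shared vertices [b] and [d], it becomes interior to both
    triangles [bcd] and [abd]. *)
Lemma affine_dep_cross A B a b c d (wa wb wc wd : R) :
  tri_closed A -> tri_closed B ->
  A b -> A c -> A d -> B a -> B b -> B d ->
  orient b c d != 0 -> orient a b d != 0 ->
  0 < wa -> 0 < wb -> wc < 0 -> wd < 0 ->
  wa + wb + wc + wd = 0 ->
  wa *: a + wb *: b + wc *: c + wd *: d = 0 ->
  relint A `&` relint B !=set0.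
Proof.
move=> hA hB Ab Ac Ad Ba Bb Bd DA DB wa0 wb0 wc0 wd0 ws wv.
pose s := wa + wb.
have s0 : 0 < s by rewrite addr_gt0.
have sn : s != 0 by rewrite gt_eqF.
(* The centroid of [b], [d] and the crossing point of [ab] and [cd]. *)
pose x := (wa / s / 3) *: a + ((wb / s + 1) / 3) *: b + (1 / 3 : R) *: d.
have xE : x = (1 / 3 : R) *: b + (- wc / s / 3) *: c
              + ((- wd / s + 1) / 3) *: d.
  apply/eqP; rewrite -subr_eq0; apply/eqP.
  (* The two expressions for [x] differ by [(3 * s)^-1] times the affine dependence. *)
  rewrite -[RHS](scaler0 _ ((3 * s)^-1)) -wv.
  by apply: cV2P; rewrite !mxE /=; field.
have f1 : 0 < wa / s by rewrite divr_gt0.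
have f2 : 0 < wb / s by rewrite divr_gt0.
have f3 : 0 < - wc / s by rewrite divr_gt0 // oppr_gt0.
have f4 : 0 < - wd / s by rewrite divr_gt0 // oppr_gt0.
have e1 : wa / s + wb / s = 1 by rewrite -mulrDl divff.
have e2 : - wc / s + - wd / s = 1.
  by rewrite -mulrDl (_ : - wc + - wd = s) ?divff// /s; clear -ws; lra.
exists x; split.
  by rewrite xE; apply: relint_triangle => //; clear -f3 f4 e2; lra.
by apply: relint_triangle => //; clear -f1 f2 e1; lra.
Qed.

(** Four points of the plane are affinely dependent, and since no three are collinear all weights
    are nonzero. Their signs split 1+3 or 2+2, as in Radon's theorem, and either split is
    contradictory. *)
Lemma no_four_points (T : set 'cV[R]_2) (Q : 'cV[R]_2 -> set 'cV[R]_2) a b c d :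
  (forall v, T v -> [/\ tri_closed (Q v), ~ Q v v
                      & forall u, T u -> u <> v -> ext (Q v) u]) ->
  (forall u v, T u -> T v -> u <> v -> relint (Q u) `&` relint (Q v) = set0) ->
  T a -> T b -> T c -> T d -> ~ uniq [:: a; b; c; d].
Proof.
move=> hQ hrel Ta Tb Tc Td.
pose distinct (u v w z : 'cV[R]_2) :=
  [/\ u <> v, u <> w, u <> z & [/\ v <> w, v <> z & w <> z]].
(* The fourth point [z] supplies the cell [Q z], in which the other three are extreme. *)
have noncol u v w z : T u -> T v -> T w -> T z -> distinct u v w z ->
    orient u v w != 0.
  move=> Tu Tv Tw Tz [uv uw uz [vw vz wz]].
  by have [_ _ he] := hQ z Tz; apply: (@ext_orient_neq0 (Q z)) => //; exact: he.
have inside u v w z (wu wv ww wz : R) :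
    T u -> T v -> T w -> T z -> distinct u v w z ->
    0 < wu -> wv < 0 -> ww < 0 -> wz < 0 ->
    wu + wv + ww + wz = 0 -> wu *: u + wv *: v + ww *: w + wz *: z = 0 -> False.
  move=> Tu Tv Tw Tz [uv uw uz _] u0 v0 w0 z0 ws wvec.
  have [hc hn he] := hQ u Tu; apply: hn.
  apply: (affine_dep_inside hc _ _ _ u0 v0 w0 z0 ws wvec) => //.
  - by case: (he v Tv (nesym uv)).
  - by case: (he w Tw (nesym uw)).
  - by case: (he z Tz (nesym uz)).
have cross u v w z (wu wv ww wz : R) :
    T u -> T v -> T w -> T z -> distinct u v w z ->
    0 < wu -> 0 < wv -> ww < 0 -> wz < 0 ->
    wu + wv + ww + wz = 0 -> wu *: u + wv *: v + ww *: w + wz *: z = 0 -> False.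
  move=> Tu Tv Tw Tz [uv uw uz [vw vz wz']] u0 v0 w0 z0 ws wvec.
  have D1 : orient v w z != 0.
    by apply: (noncol v w z u) => //; do ?split=> //; exact: nesym.
  have D2 : orient u v z != 0.
    by apply: (noncol u v z w) => //; do ?split=> //; exact: nesym.
  have [hcu _ heu] := hQ u Tu; have [hcw _ hew] := hQ w Tw.
  have : relint (Q u) `&` relint (Q w) !=set0.
    apply: (affine_dep_cross hcu hcw _ _ _ _ _ _ D1 D2 u0 v0 w0 z0 ws wvec).
    - by case: (heu v Tv (nesym uv)).
    - by case: (heu w Tw (nesym uw)).
    - by case: (heu z Tz (nesym uz)).
    - by case: (hew u Tu uw).
    - by case: (hew v Tv vw).
    - by case: (hew z Tz (nesym wz')).
  by rewrite hrel// => -[].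
move=> /=; rewrite !inE !negb_or -!andbA.
move=> /and5P[/eqP ab /eqP ac /eqP ad /eqP bc /and3P[/eqP bd /eqP cd _]].
(* A global sign change allows the weight of [a] to be taken positive. One or three positive weights
   lead to [inside] (three after negation), two lead to [cross], and four contradict the zero
   sum. *)
have signs wa wb wc wd : 0 < wa -> wb != 0 -> wc != 0 -> wd != 0 ->
    wa + wb + wc + wd = 0 -> wa *: a + wb *: b + wc *: c + wd *: d = 0 -> False.
  move=> wa0 wbn wcn wdn ws wv.
  have wsN : - wa - wb - wc - wd = 0 by rewrite -!opprD ws oppr0.
  have wvN : - wa *: a - wb *: b - wc *: c - wd *: d = 0.
    by rewrite scaleNr -!opprD wv oppr0.
  have [wb0|wb0|/eqP] := ltgtP wb 0; last by rewrite (negPf wbn).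
  - have [wc0|wc0|/eqP] := ltgtP wc 0; last by rewrite (negPf wcn).
    + have [wd0|wd0|/eqP] := ltgtP wd 0; last by rewrite (negPf wdn).
      * exact: (inside a b c d wa wb wc wd).
      * apply: (cross a d b c wa wd wb wc) => //.
        - by do ?split=> //; exact: nesym.
        - by rewrite -ws; ring.
        - by rewrite -wv; apply: cV2P; rewrite !mxE; ring.
    + have [wd0|wd0|/eqP] := ltgtP wd 0; last by rewrite (negPf wdn).
      * apply: (cross a c b d wa wc wb wd) => //.
        - by do ?split=> //; exact: nesym.
        - by rewrite -ws; ring.
        - by rewrite -wv; apply: cV2P; rewrite !mxE; ring.
      * apply: (inside b a c d (- wb) (- wa) (- wc) (- wd));
          rewrite ?oppr_gt0 ?oppr_lt0 //.
        - by do ?split=> //; exact: nesym.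
        - by rewrite -wsN; ring.
        - by rewrite -wvN; apply: cV2P; rewrite !mxE; ring.
  - have [wc0|wc0|/eqP] := ltgtP wc 0; last by rewrite (negPf wcn).
    + have [wd0|wd0|/eqP] := ltgtP wd 0; last by rewrite (negPf wdn).
      * exact: (cross a b c d wa wb wc wd).
      * apply: (inside c a b d (- wc) (- wa) (- wb) (- wd));
          rewrite ?oppr_gt0 ?oppr_lt0 //.
        - by do ?split=> //; exact: nesym.
        - by rewrite -wsN; ring.
        - by rewrite -wvN; apply: cV2P; rewrite !mxE; ring.
    + have [wd0|wd0|/eqP] := ltgtP wd 0; last by rewrite (negPf wdn).
      * apply: (inside d a b c (- wd) (- wa) (- wb) (- wc));
          rewrite ?oppr_gt0 ?oppr_lt0 //.
        - by do ?split=> //; exact: nesym.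
        - by rewrite -wsN; ring.
        - by rewrite -wvN; apply: cV2P; rewrite !mxE; ring.
      * by clear -ws wa0 wb0 wc0 wd0; lra.
have Da : orient b c d != 0.
  by apply: (noncol b c d a) => //; do ?split=> //; exact: nesym.
have Db : orient a c d != 0.
  by apply: (noncol a c d b) => //; do ?split=> //; exact: nesym.
have Dc : orient a b d != 0.
  by apply: (noncol a b d c) => //; do ?split=> //; exact: nesym.
have Dd : orient a b c != 0.
  by apply: (noncol a b c d) => //; do ?split=> //; exact: nesym.
(* Cramer's rule: the signed areas are the weights of the affine dependence. *)
have [Da0|Da0|/eqP] := ltgtP (orient b c d) 0; last by rewrite (negPf Da).
- apply: (signs (- orient b c d) (orient a c d) (- orient a b d) (orient a b c));
    rewrite ?oppr_gt0 ?oppr_eq0 //.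
  + by rewrite /orient; ring.
  + by apply: cV2P; rewrite /orient !mxE; ring.
- apply: (signs (orient b c d) (- orient a c d) (orient a b d) (- orient a b c));
    rewrite ?oppr_eq0 //.
  + by rewrite /orient; ring.
  + by apply: cV2P; rewrite /orient !mxE; ring.
Qed.

End Plane.

(** * From lists of points to the rank bound *)

(** An infinite set contains a finite subset of more than [n] elements, so the bound on
    duplicate-free lists also excludes the value [+oo]. *)
Lemma counting_le (R : realType) (V : choiceType) (A : set V) n :
  (forall s : seq V, uniq s -> [set` s] `<=` A -> (size s <= n)%N) ->
  (counting A <= n%:R%:E :> \bar R)%E.
Proof.
move=> hA; rewrite /counting; case: ifPn => [/asboolP Afin|/asboolPn Ainf].
  rewrite lee_fin ler_nat; apply: hA; first exact: fset_uniq.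
  by move=> x /=; rewrite in_fset_set// => /set_mem.
have [B BA nB] := infinite_set_fset n.+1 Ainf.
by move: (hA _ (fset_uniq B) BA); rewrite leqNgt nB.
Qed.

Theorem theorem2 (R : realType) (Omega : set 'cV[R]_2) (d : nat)
    (P : 'I_d -> set 'cV[R]_2) (J : set 'cV[R]_2) (F : set (set 'cV[R]_2))
    (hOmega : bounded_set Omega)
    (hP : polyhedral_partition Omega P)
    (hJ : J = \bigcup_i ext (P i))
    (hvertex : forall (i : 'I_d) (v : 'cV[R]_2), J v -> (P i v <-> ext (P i) v))
    (hF : F = [set ext (P i) | i in [set: 'I_d]])
    (hirr : irredundant F) :
  (hrank R (conflict_hypergraph J F) <= 3%:E)%E.
Proof.
have [hpoly _ hrel] := hP.
rewrite /hrank ge_max lee_fin ler0n /=.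
apply: ge_ereal_sup => _ [T [TJ Tinf Tmin] <-].
apply: counting_le => s us sT.
have cell v : T v ->
    exists i, ~ P i v /\ (forall u, T u -> u <> v -> ext (P i) u).
  move=> Tv; have : feasible F (T `\ v).
    apply: contrapT => /(Tmin _ (@subDsetl _ _ _)) TE.
    by have : (T `\ v) v; [rewrite TE|case=> _; apply].
  rewrite hF => -[_ [i _ <-] hi]; exists i; split; last first.
    by move=> u Tu uv; apply: hi; split.
  move=> /(hvertex i v (TJ _ Tv)) ev; apply: Tinf.
  exists (ext (P i)); first by rewrite hF; exists i.
  by move=> u Tu; have [->//|/eqP uv] := eqVneq u v; apply: hi; split.
rewrite leqNgt; apply/negP => s4.
case: s us sT s4 => [|a [|b [|c [|e s]]]] //= us sT _.
have Tmem x : x \in [:: a, b, c, e & s] -> T x by move=> xs; exact: sT.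
have Ta : T a by apply: Tmem; rewrite !inE eqxx.
have [i0 _] := cell a Ta.
have [f hf] : {f : 'cV[R]_2 -> 'I_d & forall v, T v ->
    ~ P (f v) v /\ (forall u, T u -> u <> v -> ext (P (f v)) u)}.
  apply: (@choice _ _ (fun v i => T v -> ~ P i v /\
    (forall u, T u -> u <> v -> ext (P i) u))) => v.
  by have [Tv|nTv] := pselect (T v); [have [i hi] := cell v Tv; exists i|exists i0].
apply: (@no_four_points R T (P \o f) a b c e) => //.
- move=> v Tv; have [h1 h2] := hf v Tv; split=> //.
  by apply: polyhedron_tri_closed; case: (hpoly (f v)).
- move=> u v Tu Tv uv; apply: hrel; apply/eqP => fuv.
  have [hn _] := hf u Tu; apply: hn; rewrite fuv.
  by have [_ he] := hf v Tv; case: (he u Tu uv).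
- by apply: Tmem; rewrite !inE eqxx ?orbT.
- by apply: Tmem; rewrite !inE eqxx ?orbT.
- by apply: Tmem; rewrite !inE eqxx ?orbT.
- have : uniq ([:: a; b; c; e] ++ s) by [].
  by rewrite cat_uniq => /andP[].
Qed.
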